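(* Let $N\ge3$, let $\lambda_1,\dots,\lambda_N>0$ with $\sum_{i=1}^N\lambda_i=1$, let $S,Y\subseteq\mathbb R^n$ be compact, let $\rho\in\mathcal P_{\mathrm{ac}}(S)$ and $\mu_2,\dots,\mu_N\in\mathcal P(Y)$. Let $(T_2,\dots,T_N)$ be the multi-marginal optimal transport maps associated with $(\rho,\mu_2,\dots,\mu_N)$ for the barycentric quadratic cost $c$, let $(\varphi_1,\dots,\varphi_N)$ be a $c$-conjugate tuple of Kantorovich potentials for this problem, and let $R(x_1,\dots,x_N):=c(x_1,\dots,x_N)-\sum_{i=1}^N\varphi_i(x_i)$. Then, for $\rho$-a.e. $x_1\in S$ and every $x_2,\dots,x_N\in Y$, $$R(x_1,x_2,\dots,x_N)\ge\frac14\sum_{i=2}^N\lambda_i^2|V_{i,x}-V_i(x_1)|^2-\frac32|B_x-B(x_1)|^2.$$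
   Context: $\mathcal P(E)$ is the set of Borel probability measures on $E$; $\mathcal P_{\mathrm{ac}}(S)$ is the set of probability measures on $S$ absolutely continuous with respect to Lebesgue measure. The barycentric quadratic cost is $c(x_1,\dots,x_N)=\inf_{y\in\mathbb R^n}\sum_{i=1}^N\frac{\lambda_i}{2}|x_i-y|^2=\frac12\sum_{1\le i<j\le N}\lambda_i\lambda_j|x_i-x_j|^2$. The multi-marginal optimal transport maps associated with $(\rho,\mu_2,\dots,\mu_N)$ are the ($\rho$-a.e. unique, by a theorem of Gangbo and Święch) minimizers $(T_2,\dots,T_N)$ of $\int_S c(x_1,T_2(x_1),\dots,T_N(x_1))\,d\rho(x_1)$ among maps $T_i:S\to Y$ with $(T_i)_\#\rho=\mu_i$, $i=2,\dots,N$; moreover $(\mathrm{Id},T_2,\dots,T_N)_\#\rho$ minimizes $\int c\,d\pi$ over all probability measures $\pi$ on $S\times Y^{N-1}$ with marginals $\rho,\mu_2,\dots,\mu_N$. A $c$-conjugate tuple of Kantorovich potentials: functions $\varphi_1$ on $S$ and $\varphi_i$ on $Y$ ($i\ge2$) maximizing $\int\varphi_1\,d\rho+\sum_{i\ge2}\int\varphi_i\,d\mu_i$ subject to $\sum_{i=1}^N\varphi_i(x_i)\le c(x_1,\dots,x_N)$ on $S\times Y^{N-1}$, and such that for each $i$, $\varphi_i(x_i)=\inf\{c(x_1,\dots,x_N)-\sum_{j\ne i}\varphi_j(x_j)\}$, the infimum being over the other variables. Thus $R\ge0$ on $S\times Y^{N-1}$, and by duality $R(x_1,T_2(x_1),\dots,T_N(x_1))=0$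 for $\rho$-a.e. $x_1$. Notation: for $(x_1,\dots,x_N)\in S\times Y^{N-1}$, $B_x=\sum_{i=1}^N\lambda_ix_i$, $M_x=\frac{1}{1-\lambda_1}\sum_{i=2}^N\lambda_ix_i$, $V_{i,x}=x_i-M_x$ for $i=2,\dots,N$. For $x_1\in S$, $B(x_1)=\lambda_1x_1+\sum_{i=2}^N\lambda_iT_i(x_1)$, $M(x_1)=\frac1{1-\lambda_1}\sum_{i=2}^N\lambda_iT_i(x_1)$, $V_i(x_1)=T_i(x_1)-M(x_1)$ for $i=2,\dots,N$. *)

(* Defs.v *)
From HB Require Import structures.
From mathcomp Require Import all_boot all_order all_algebra.
From mathcomp Require Import all_classical all_reals all_analysis.
From mathcomp Require Import measurable_realfun ring lra.

Set Implicit Arguments.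
Unset Strict Implicit.
Unset Printing Implicit Defensive.

Import Order.TTheory GRing.Theory Num.Theory.
Import numFieldNormedType.Exports.

Local Open Scope classical_set_scope.
Local Open Scope ring_scope.

HB.instance Definition _ (R : realType) (n : nat) :=
  Measurable.copy 'rV[R]_n (g_sigma_algebraType (@open 'rV[R]_n)).

Section BorelRn.
Context (R : realType).

Lemma open_measurable_rV n (A : set 'rV[R]_n) : open A -> measurable A.
Proof. by move=> oA; exact: sub_sigma_algebra. Qed.

Lemma compact_measurable_rV n (A : set 'rV[R]_n) : compact A -> measurable A.
Proof.
move=> cA; rewrite -[A]setCK; apply: measurableC; apply: open_measurable_rV.
apply: closed_openC; apply: compact_closed cA; exact: norm_hausdorff.
Qed.

Lemma measurable_coord_rV n (i : 'I_n) :
  measurable_fun [set: 'rV[R]_n] (fun v : 'rV[R]_n => v 0 i).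
Proof.
apply: (measurability _ (RGenOpens.measurableE R)).
move=> _ [_ [a [b ->] <-]]; rewrite setTI; apply: open_measurable_rV.
have /continuousP := @coord_continuous R 1 n 0 i; apply.
exact: interval_open.
Qed.

Lemma measurable_fun_rV d (T : measurableType d) (D : set T) n
    (f : T -> 'rV[R]_n) :
  (forall i, measurable_fun D (fun x => f x 0 i)) -> measurable_fun D f.
Proof.
move=> mf mD; apply: (@measurability _ _ _ _ _ _ (@open 'rV[R]_n)) => //.
move=> _ [U oU <-].
pose box (q : {ffun 'I_n -> rat * rat}) : set 'rV[R]_n :=
  [set v | forall i, v 0 i \in `]ratr (q i).1, ratr (q i).2[].
have UE : U = \bigcup_(q in [set q | box q `<=` U]) box q.
  apply/seteqP; split=> [v Uv|v [q /= qU qv]]; last exact: qU.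
  have /nbhs_ballP[e /= e0 eU] := open_nbhs_nbhs (conj oU Uv).
  have He i : exists ab : rat * rat,
      [/\ v 0 i \in `]ratr ab.1, ratr ab.2[%R,
          v 0 i - e < ratr ab.1 & ratr ab.2 < v 0 i + e].
    have /rat_in_itvoo[a] : v 0 i - e < v 0 i by rewrite ltrBlDr ltrDl.
    have /rat_in_itvoo[b] : v 0 i < v 0 i + e by rewrite ltrDl.
    rewrite !in_itv/= => /andP[b1 b2] /andP[a1 a2].
    by exists (a, b); rewrite in_itv/= a2 b1.
  exists [ffun i => proj1_sig (cid (He i))] => /=.
    move=> w wb; apply: eU; split => // i j; rewrite ord1.
    have := wb j; rewrite ffunE; case: (cid (He j)) => /= ab [_ h1 h2].
    rewrite in_itv/= => /andP[h3 h4].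
    rewrite /ball/= ltr_distlC; apply/andP; split; first exact: lt_trans h3.
    exact: lt_trans h2.
  by move=> i; rewrite ffunE; case: (cid (He i)) => /= ab [].
rewrite UE preimage_bigcup setI_bigcupr bigcup_mkcond.
rewrite [X in measurable X](_ : _ = \bigcup_k
    oapp (fun q => if q \in [set q | box q `<=` U] then D `&` f @^-1` box q
                   else set0) set0 (unpickle k)); last first.
  apply/seteqP; split=> [x [q _ qx]|x [k _]].
    by exists (pickle q) => //; rewrite pickleK.
  by case: unpickle => //= q qx; exists q.
apply: bigcupT_measurable => k; case: unpickle => //= q; case: ifPn => // _.
rewrite [X in measurable X](_ : _ = D `&` \bigcap_(i in [set: 'I_n])
  (D `&` (fun x => f x 0 i) @^-1` [set` `]ratr (q i).1, ratr (q i).2[%R])).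
  apply: measurableI => //; apply: fin_bigcap_measurable; first exact: finite_finset.
  by move=> i _; apply: mf => //; exact: measurable_itv.
apply/seteqP; split=> x [Dx h]; split=> //= i; first by move=> _; split=> //; exact: h.
by have [] := h i I.
Qed.

Definition rV_rcons n (p : 'rV[R]_n * measurableTypeR R) : 'rV[R]_n.+1 :=
  \row_(i < n.+1) oapp (fun j => p.1 0 j) p.2 (unlift ord_max i).

Lemma measurable_rV_rcons n :
  measurable_fun [set: 'rV[R]_n * measurableTypeR R] (@rV_rcons n).
Proof.
apply: measurable_fun_rV => i; rewrite /rV_rcons.
case: (unliftP ord_max i) => [j ->|->].
  under eq_fun do rewrite mxE liftK /=.
  apply: (measurableT_comp (measurable_coord_rV j)); exact: measurable_fst.
under eq_fun do rewrite mxE unlift_none /=.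
exact: measurable_snd.
Qed.

End BorelRn.

Section LebesgueRn.
Context (R : realType) (n : nat) (m : {measure set 'rV[R]_n -> \bar R}).

Let step : set 'rV[R]_n.+1 -> \bar R :=
  pushforward (m \x @lebesgue_measure R)%E (@rV_rcons R n).

Let mf := @measurable_rV_rcons R n.

Let step0 : step set0 = 0%E. Proof. exact: measure0. Qed.

Let step_ge0 A : (0 <= step A)%E. Proof. exact: measure_ge0. Qed.

Let step_sigma_additive : semi_sigma_additive step.
Proof. exact: measure_semi_sigma_additive. Qed.

HB.instance Definition _ := isMeasure.Build _ _ _ step
  step0 step_ge0 step_sigma_additive.

Definition lebesgue_rV_step : {measure set 'rV[R]_n.+1 -> \bar R} := step.

End LebesgueRn.

(* The n-fold product of the one-dimensional Lebesgue measure, transported to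
   row vectors; it is the unit mass at the origin for n = 0. *)
Fixpoint lebesgue_rV (R : realType) (n : nat) :
    {measure set 'rV[R]_n -> \bar R} :=
  match n with
  | 0 => \d_(0 : 'rV[R]_0)
  | n'.+1 => lebesgue_rV_step (lebesgue_rV R n')
  end.

Lemma lebesgue_rV_box (R : realType) (n : nat) (a b : 'rV[R]_n) :
  (forall i, a 0 i <= b 0 i) ->
  lebesgue_rV R n [set v | forall i, v 0 i \in `[a 0 i, b 0 i]] =
  (\prod_(i < n) (b 0 i - a 0 i))%:E.
Proof.
elim: n a b => [|n IH] a b ab.
  rewrite big_ord0 /= diracE mem_set// => -[].
  by [].
rewrite big_ord_recr/= EFinM.
pose a' : 'rV[R]_n := \row_i a 0 (widen_ord (leqnSn n) i).
pose b' : 'rV[R]_n := \row_i b 0 (widen_ord (leqnSn n) i).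
have lift_widen (j : 'I_n) : lift ord_max j = widen_ord (leqnSn n) j.
  by apply: val_inj; rewrite /= /bump leqNgt ltn_ord.
transitivity ((lebesgue_rV R n \x @lebesgue_measure R)%E
  ([set v : 'rV[R]_n | forall i, v 0 i \in `[a' 0 i, b' 0 i]] `*`
   [set` `[a 0 ord_max, b 0 ord_max]])).
  congr ((_ \x _)%E _); apply/seteqP; split=> [[v t]/= h|[v t]/= [h ht] i].
    split=> [i|].
      have := h (lift ord_max i).
      by rewrite /rV_rcons !mxE liftK/= lift_widen.
    by have := h ord_max; rewrite /rV_rcons !mxE unlift_none.
  rewrite /rV_rcons mxE; case: (unliftP ord_max i) => [j ->|->] //=.
  by have := h j; rewrite !mxE lift_widen.
rewrite product_measure1E/=; last 2 first.
- rewrite [X in measurable X](_ : _ = \bigcap_(i in [set: 'I_n])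
    ((fun v : 'rV[R]_n => v 0 i) @^-1` [set` `[a' 0 i, b' 0 i]])).
    apply: fin_bigcap_measurable; first exact: finite_finset.
    move=> i _; rewrite -[X in measurable X]setTI.
    exact: measurable_coord_rV.
  by apply/seteqP; split=> v /= h i; [move=> _|]; exact: h.
- exact: measurable_itv.
rewrite IH; last by move=> i; rewrite !mxE.
rewrite lebesgue_measure_itv/= lte_fin; congr (_ * _)%E.
  by congr EFin; apply: eq_bigr => i _; rewrite !mxE.
case: ltP => [_|]; first by rewrite EFinD.
by move=> ba; rewrite (_ : b 0 ord_max = a 0 ord_max) ?subrr//; apply/eqP; rewrite eq_le ba ab.
Qed.

Section Barycenter.
Context (R : realType) (n : nat).
Implicit Types (v y : 'rV[R]_n).

(* squared Euclidean norm; the library's norm on row vectors is the max norm *)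
Definition sqnorm v : R := \sum_(k < n) v 0 k ^+ 2.

Definition bary_cost N (lam : 'I_N -> R) (x : 'I_N -> 'rV[R]_n) : R :=
  inf [set \sum_(i < N) lam i / 2 * sqnorm (x i - y) | y in [set: 'rV[R]_n]].

Definition barycenter N (lam : 'I_N -> R) (x : 'I_N -> 'rV[R]_n) : 'rV[R]_n :=
  \sum_(i < N) lam i *: x i.

Lemma bary_costE N (lam : 'I_N -> R) (x : 'I_N -> 'rV[R]_n) :
  \sum_(i < N) lam i = 1 ->
  bary_cost lam x =
  2^-1 * \sum_(i < N) \sum_(j < N | (i < j)%N)
           lam i * lam j * sqnorm (x i - x j).
Proof.
move=> lam1.
set b := barycenter lam x; set D := (X in _ = X).
have pairE (F : 'I_N -> 'I_N -> R) : (forall i j, F i j = F j i) ->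
    (forall i, F i i = 0) ->
    \sum_i \sum_j F i j = 2 * \sum_(i < N) \sum_(j < N | (i < j)%N) F i j.
  move=> Fsym F0.
  have E : \sum_(i < N) \sum_(j < N | (j < i)%N) F i j =
           \sum_(i < N) \sum_(j < N | (i < j)%N) F i j.
    rewrite (exchange_big_dep xpredT)//=; apply: eq_bigr => i _.
    by apply: eq_bigr => j _; exact: Fsym.
  transitivity (\sum_(i < N) (\sum_(j < N | (i < j)%N) F i j +
                        \sum_(j < N | (j < i)%N) F i j)).
    apply: eq_bigr => i _.
    rewrite (bigID (fun j : 'I_N => (i < j)%N))/=; congr (_ + _).
    rewrite (bigD1 i)/= ?ltnn// F0 add0r; apply: eq_bigl => j.
    by rewrite -leqNgt ltn_neqAle andbC.
  by rewrite big_split/= E mulr2n mulrDl !mul1r.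
have key y : \sum_(i < N) lam i / 2 * sqnorm (x i - y) =
    2^-1 * sqnorm (y - b) + D.
  pose a i k := x i 0 k.
  have bE k : b 0 k = \sum_i lam i * a i k.
    by rewrite /b /barycenter summxE; apply: eq_bigr => i _; rewrite mxE.
  have DE : D = 2^-1 * \sum_(k < n) (\sum_i lam i * a i k ^+ 2 - b 0 k ^+ 2).
    rewrite /D; congr (_ * _).
    apply: (@mulfI _ 2); first by rewrite pnatr_eq0.
    rewrite -pairE; last 2 first.
    - move=> i j; rewrite (mulrC (lam i)); congr (_ * _).
      by apply: eq_bigr => k _; rewrite !mxE -sqrrN opprB.
    - move=> i; rewrite subrr /sqnorm big1 ?mulr0// => k _.
      by rewrite mxE expr0n.
    rewrite mulr_sumr.
    under eq_bigr do under eq_bigr do rewrite mulr_sumr.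
    under eq_bigr do rewrite exchange_big/=.
    rewrite exchange_big/=; apply: eq_bigr => k _.
    transitivity (\sum_i (lam i * a i k ^+ 2 - 2 * (lam i * a i k) * b 0 k
        + lam i * \sum_j lam j * a j k ^+ 2)).
      apply: eq_bigr => i _.
      rewrite -[X in X - _ + _]mulr1 -[in X in X - _ + _]lam1 bE.
      rewrite !mulr_sumr -sumrB -big_split/=; apply: eq_bigr => j _.
      by rewrite !mxE /a; ring.
    rewrite big_split/= -mulr_suml lam1 sumrB -mulr_suml -mulr_sumr -bE.
    by ring.
  rewrite DE -mulrDr; have -> : \sum_(i < N) lam i / 2 * sqnorm (x i - y) =
     2^-1 * \sum_i lam i * sqnorm (x i - y).
    by rewrite mulr_sumr; apply: eq_bigr => i _; ring.
  congr (_ * _); rewrite -big_split/=.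
  under eq_bigr do rewrite mulr_sumr.
  rewrite exchange_big/=; apply: eq_bigr => k _.
  transitivity (\sum_i (lam i * a i k ^+ 2 - 2 * (lam i * a i k) * y 0 k
                        + lam i * y 0 k ^+ 2)).
    by apply: eq_bigr => i _; rewrite !mxE /a; ring.
  rewrite big_split/= -mulr_suml lam1 sumrB -mulr_suml -mulr_sumr -bE !mxE.
  by ring.
have sq0 v : 0 <= sqnorm v by apply: sumr_ge0 => k _; exact: sqr_ge0.
have Dmin : lbound [set \sum_(i < N) lam i / 2 * sqnorm (x i - y)
                   | y in [set: 'rV[R]_n]] D.
  by move=> _ [y _ <-]; rewrite key lerDr mulr_ge0.
apply/eqP; rewrite eq_le; apply/andP; split.
  apply: ge_inf; first by exists D.
  exists b => //; rewrite key subrr (_ : sqnorm 0 = 0) ?mulr0 ?add0r//.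
  by rewrite /sqnorm big1// => k _; rewrite mxE expr0n.
by apply: lb_le_inf => //; exists (\sum_(i < N) lam i / 2 * sqnorm (x i - 0)), 0.
Qed.

(* The tuple (x_1, x_2, ..., x_N), where N = m + 1: the coordinate x_1 has index
   [ord0] and x_2, ..., x_N have the indices [lift ord0 i] with i : 'I_m. *)
Definition tcons (A : Type) m (a : A) (s : 'I_m -> A) (i : 'I_m.+1) : A :=
  oapp s a (unlift ord0 i).

Definition tail_mean m (lam : 'I_m.+1 -> R) (x : 'I_m.+1 -> 'rV[R]_n) :
    'rV[R]_n :=
  (1 - lam ord0)^-1 *: \sum_(i < m) lam (lift ord0 i) *: x (lift ord0 i).

Definition tail_dev m (lam : 'I_m.+1 -> R) (x : 'I_m.+1 -> 'rV[R]_n)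
    (i : 'I_m) : 'rV[R]_n :=
  x (lift ord0 i) - tail_mean lam x.

End Barycenter.

Section MultiMarginal.
Context (R : realType) (n m : nat) (lam : 'I_m.+1 -> R).
Context (S Y : set 'rV[R]_n) (rho : probability 'rV[R]_n R)
  (mu : 'I_m -> probability 'rV[R]_n R).

(* S x Y^(N-1) *)
Definition tuple_dom (x : 'I_m.+1 -> 'rV[R]_n) : Prop :=
  forall i, tcons S (fun=> Y) i (x i).

Definition graph_tuple (T : 'I_m -> 'rV[R]_n -> 'rV[R]_n) (x1 : 'rV[R]_n) :
    'I_m.+1 -> 'rV[R]_n :=
  tcons x1 (fun i => T i x1).

(* Maps are total on R^n, but only their restriction to S matters. *)
Definition transport_maps (T : 'I_m -> 'rV[R]_n -> 'rV[R]_n) : Prop :=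
  forall i, [/\ forall x, S x -> Y (T i x),
    measurable_fun S (T i) &
    forall A, measurable A -> rho (S `&` T i @^-1` A) = mu i A].

Definition transport_cost (T : 'I_m -> 'rV[R]_n -> 'rV[R]_n) : \bar R :=
  (\int[rho]_(x in S) (bary_cost lam (graph_tuple T x))%:E)%E.

Definition optimal_maps (T : 'I_m -> 'rV[R]_n -> 'rV[R]_n) : Prop :=
  transport_maps T /\
  forall T', transport_maps T' -> (transport_cost T <= transport_cost T')%E.

Definition residual (phi : 'I_m.+1 -> 'rV[R]_n -> R)
    (x : 'I_m.+1 -> 'rV[R]_n) : R :=
  bary_cost lam x - \sum_(i < m.+1) phi i (x i).

Definition dual_feasible (phi : 'I_m.+1 -> 'rV[R]_n -> R) : Prop :=
  (forall i, (tcons rho mu i).-integrable (tcons S (fun=> Y) i)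
               (EFin \o phi i)) /\
  (forall x, tuple_dom x ->
     \sum_(i < m.+1) phi i (x i) <= bary_cost lam x).

Definition dual_value (phi : 'I_m.+1 -> 'rV[R]_n -> R) : \bar R :=
  (\sum_(i < m.+1)
     \int[tcons rho mu i]_(x in tcons S (fun=> Y) i) (phi i x)%:E)%E.

Definition c_conjugate (phi : 'I_m.+1 -> 'rV[R]_n -> R) : Prop :=
  forall i xi, tcons S (fun=> Y) i xi ->
    phi i xi = inf [set bary_cost lam x - \sum_(j < m.+1 | j != i) phi j (x j)
                   | x in [set x | tuple_dom x /\ x i = xi]].

Definition kantorovich_potentials (phi : 'I_m.+1 -> 'rV[R]_n -> R) : Prop :=
  [/\ dual_feasible phi,
      forall psi, dual_feasible psi -> (dual_value psi <= dual_value phi)%E &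
      c_conjugate phi].

End MultiMarginal.

(* Main.v *)
Require Import Defs.
From HB Require Import structures.
From mathcomp Require Import all_boot all_order all_algebra.
From mathcomp Require Import all_classical all_reals all_analysis.
From mathcomp Require Import measurable_realfun ring lra.

(** Completing the square, [bary_cost lam x] is the sum of the
    [lam i / 2 * sqnorm (x i)] minus half the square of the barycenter. So the
    functions [u i z = lam i / 2 * sqnorm z - phi i z] satisfy: the sum of the
    [u i (x i)] dominates half the squared barycenter, and the residual is the
    defect. At a tuple of zero residual (a contact tuple) with barycenter [b], the
    expansion of the square shows that each [u i] is strongly convex there, with
    subgradient [lam i *: b] and modulus [lam i ^+ 2]
    ([contact_strongly_convex]). If the graph of [T] over [x1] is a contact tuple,
    adding these inequalities over the coordinates other than the first bounds
    the residual of every tuple over [x1] from below by half the weighted squared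
    displacements minus half the squared displacement of the barycenter, and the
    parallelogram inequality turns displacements into deviations from the tail
    mean ([residual_ge_tail_dev]).

    What remains is that the graph of optimal maps consists of contact tuples
    almost everywhere ([optimal_maps_contact]). This is a statement of duality
    without gap, obtained from the optimality of the potentials alone.

    - The potentials are infima of continuous functions on a compact domain, so
      the tuples in contact up to [e] form a compact set ([contact_set_closed],
      [tuple_dom_compact]) and there is a contact tuple above every point of [S].

    - It is unique almost everywhere. Strong convexity makes the barycenter a
      monotone function of the first coordinate and makes a contact tuple
      determined by its barycenter. If two contact tuples lie above a point, their
      barycenters leave a rational gap in some coordinate [k]; by monotonicity a
      given gap occurs at most once on each line of direction [k]
      ([branch_line]), so it occurs on a null set by Fubini
      ([lebesgue_rV_line_null]).

    - The resulting maps push [rho] to the [mu i]: raising one potential by [e] on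
      a closed set [C] and lowering the first one by [e] where [C] is reached by
      tuples in contact up to [e] is admissible, so the optimal potentials give
      [mu i C] at most the mass of that region ([closed_mass_le_shadow]). As [e]
      tends to [0] the region decreases to the preimage of [C] up to a null set;
      an inequality between probabilities on all closed sets is an equality.

    - The cost of these maps is therefore the dual value. Optimal maps cost no
      more, so the integral of their nonnegative residual vanishes
      ([transport_cost_residual]). *)

Set Implicit Arguments.
Unset Strict Implicit.
Unset Printing Implicit Defensive.

Import Order.TTheory GRing.Theory Num.Theory.
Import numFieldNormedType.Exports.

Local Open Scope classical_set_scope.
Local Open Scope ring_scope.

(** * Quadratic algebra of the barycentric cost *)

Section Euclidean.
Context (R : realType) (n : nat).
Implicit Types u v w : 'rV[R]_n.

Definition dot u v : R := \sum_(k < n) u 0 k * v 0 k.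

Lemma dotDr u v w : dot u (v + w) = dot u v + dot u w.
Proof. by rewrite -big_split; apply: eq_bigr => k _; rewrite mxE mulrDr. Qed.

Lemma dotZr a u v : dot u (a *: v) = a * dot u v.
Proof. by rewrite mulr_sumr; apply: eq_bigr => k _; rewrite mxE mulrCA. Qed.

Lemma dotNr u v : dot u (- v) = - dot u v.
Proof. by rewrite -scaleN1r dotZr mulN1r. Qed.

Lemma dot_sumr I (r : seq I) (F : I -> 'rV[R]_n) u :
  dot u (\sum_(i <- r) F i) = \sum_(i <- r) dot u (F i).
Proof.
rewrite /dot exchange_big; apply: eq_bigr => k _.
by rewrite summxE mulr_sumr.
Qed.

Lemma dotC u v : dot u v = dot v u.
Proof. by apply: eq_bigr => k _; rewrite mulrC. Qed.

Lemma dotBl u v w : dot (u - v) w = dot u w - dot v w.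
Proof. by rewrite dotC dotDr dotNr !(dotC w). Qed.

Lemma sqnormE u : sqnorm u = dot u u.
Proof. by apply: eq_bigr => k _; rewrite expr2. Qed.

Lemma sqnormD u v : sqnorm (u + v) = sqnorm u + 2 * dot u v + sqnorm v.
Proof.
rewrite !sqnormE dotDr ![dot (u + v) _]dotC !dotDr (dotC v u).
by ring.
Qed.

Lemma sqnormZ a u : sqnorm (a *: u) = a ^+ 2 * sqnorm u.
Proof. by rewrite !sqnormE dotZr dotC dotZr mulrA expr2. Qed.

Lemma sqnormN u : sqnorm (- u) = sqnorm u.
Proof. by rewrite !sqnormE dotNr dotC dotNr opprK. Qed.

Lemma sqnorm_ge0 u : 0 <= sqnorm u.
Proof. by apply: sumr_ge0 => k _; exact: sqr_ge0. Qed.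

Lemma sqnorm0 : sqnorm (0 : 'rV[R]_n) = 0.
Proof. by rewrite -(scale0r 0) sqnormZ expr0n mul0r. Qed.

Lemma sqnorm_le0 u : sqnorm u <= 0 -> u = 0.
Proof.
move=> u0; have /eqP : sqnorm u = 0 by apply/le_anti; rewrite u0 sqnorm_ge0.
rewrite psumr_eq0 => [/allP h|k _]; last exact: sqr_ge0.
apply/rowP => k; rewrite mxE; apply/eqP; rewrite -sqrf_eq0.
by apply: h; rewrite mem_index_enum.
Qed.

(** Completing the square in the auxiliary point shows that the infimum
    defining the cost is attained at the barycenter. *)
Lemma bary_cost_barycenter N (lam : 'I_N -> R) (x : 'I_N -> 'rV[R]_n) :
  \sum_(i < N) lam i = 1 ->
  bary_cost lam x =
  \sum_(i < N) lam i / 2 * sqnorm (x i) - sqnorm (barycenter lam x) / 2.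
Proof.
move=> lam1; set b := barycenter lam x; set D := RHS.
have key y : \sum_(i < N) lam i / 2 * sqnorm (x i - y) =
    sqnorm (y - b) / 2 + D.
  transitivity (\sum_(i < N) (lam i / 2 * sqnorm (x i) - dot y (lam i *: x i)
                              + lam i * (sqnorm y / 2))).
    by apply: eq_bigr => i _; rewrite sqnormD dotNr sqnormN dotZr (dotC y); field.
  rewrite big_split/= sumrB -mulr_suml lam1 -dot_sumr.
  rewrite -/(barycenter lam x) -/b /D.
  by rewrite (sqnormD y) dotNr sqnormN; field.
have Dmin : lbound [set \sum_(i < N) lam i / 2 * sqnorm (x i - y)
                   | y in [set: 'rV[R]_n]] D.
  by move=> _ [y _ <-]; rewrite key lerDr divr_ge0 ?sqnorm_ge0.
apply/le_anti/andP; split.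
  apply: ge_inf; first by exists D.
  by exists b => //; rewrite key subrr sqnorm0 mul0r add0r.
apply: lb_le_inf => //.
by exists (\sum_(i < N) lam i / 2 * sqnorm (x i - 0)), 0.
Qed.

Lemma barycenter_update N (lam : 'I_N -> R) (x : 'I_N -> 'rV[R]_n) i z :
  barycenter lam [eta x with i |-> z] = barycenter lam x + lam i *: (z - x i).
Proof.
rewrite /barycenter (bigD1 i)//= eqxx [in RHS](bigD1 i)//= scalerBr.
rewrite addrAC addrCA subrr addr0; congr (_ + _).
by apply: eq_bigr => j /negPf ->.
Qed.

End Euclidean.

Section Contact.
Context (R : realType) (n m : nat) (lam : 'I_m.+1 -> R).
Context (S Y : set 'rV[R]_n) (phi : 'I_m.+1 -> 'rV[R]_n -> R).
Implicit Types (x t : 'I_m.+1 -> 'rV[R]_n) (i : 'I_m.+1).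
Hypothesis lam_gt0 : forall i, 0 < lam i.
Hypothesis lam1 : \sum_(i < m.+1) lam i = 1.
Hypothesis feasible : forall x, tuple_dom S Y x ->
  \sum_(i < m.+1) phi i (x i) <= bary_cost lam x.

Let residualE x : residual lam phi x =
  \sum_(i < m.+1) (lam i / 2 * sqnorm (x i) - phi i (x i))
  - sqnorm (barycenter lam x) / 2.
Proof. by rewrite /residual bary_cost_barycenter// sumrB addrAC. Qed.

Lemma residual_ge0 x : tuple_dom S Y x -> 0 <= residual lam phi x.
Proof. by move=> dx; rewrite /residual subr_ge0 feasible. Qed.

Lemma tuple_dom_update x i z : tuple_dom S Y x -> tcons S (fun=> Y) i z ->
  tuple_dom S Y [eta x with i |-> z].
Proof. by move=> dx dz j /=; case: eqP => [->|_]; [|exact: dx]. Qed.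

(** Moving one coordinate of a contact tuple keeps the residual nonnegative;
    expanding the square of the moved barycenter turns this into the strong
    convexity of [lam i / 2 * sqnorm z - phi i z], with the barycenter as
    subgradient. *)
Lemma contact_strongly_convex x i z :
  tuple_dom S Y x -> residual lam phi x <= 0 -> tcons S (fun=> Y) i z ->
  lam i * dot (barycenter lam x) (z - x i) + lam i ^+ 2 / 2 * sqnorm (z - x i)
  <= (lam i / 2 * sqnorm z - phi i z)
     - (lam i / 2 * sqnorm (x i) - phi i (x i)).
Proof.
move=> dx rx dz; have := residual_ge0 (tuple_dom_update dx dz).
move: rx; rewrite !residualE barycenter_update sqnormD dotZr sqnormZ.
pose u j w := lam j / 2 * sqnorm w - phi j w.
have -> : \sum_(j < m.+1) (lam j / 2 * sqnorm ([eta x with i |-> z] j)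
                          - phi j ([eta x with i |-> z] j)) =
    \sum_(j < m.+1) u j (x j) + (u i z - u i (x i)).
  rewrite (bigD1 i)//= eqxx [in RHS](bigD1 i)//= -/(u i z).
  rewrite (eq_bigr (fun j => u j (x j))); last by move=> j /negPf ->.
  by ring.
rewrite /u.
by lra.
Qed.

(** Strong convexity applied from both ends: on contact tuples the first
    coordinate and the barycenter are monotonically related. *)
Lemma contact_monotone x x' i :
  tuple_dom S Y x -> residual lam phi x <= 0 ->
  tuple_dom S Y x' -> residual lam phi x' <= 0 ->
  lam i * sqnorm (x' i - x i) <=
  dot (barycenter lam x' - barycenter lam x) (x' i - x i).
Proof.
move=> dx rx dx' rx'; rewrite -(ler_pM2l (lam_gt0 i)).
have := contact_strongly_convex dx rx (dx' i).
have := contact_strongly_convex dx' rx' (dx i).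
rewrite -(opprB (x' i)) dotNr sqnormN dotBl.
by lra.
Qed.

Lemma contact_barycenter_inj x x' :
  tuple_dom S Y x -> residual lam phi x <= 0 ->
  tuple_dom S Y x' -> residual lam phi x' <= 0 ->
  barycenter lam x = barycenter lam x' -> x = x'.
Proof.
move=> dx rx dx' rx' bE; apply/funext => i.
have := contact_monotone i dx rx dx' rx'; rewrite bE dotBl subrr pmulr_rle0// => /sqnorm_le0/eqP.
by rewrite subr_eq0 => /eqP.
Qed.

(** Summing the strong convexity inequalities over the coordinates other than
    the first: the first order terms add up to the pairing of the barycenter
    with its displacement because the first coordinates agree. *)
Lemma residual_ge_displacement x t :
  tuple_dom S Y x -> tuple_dom S Y t -> residual lam phi t <= 0 ->
  x ord0 = t ord0 ->
  \sum_(i < m) lam (lift ord0 i) ^+ 2 / 2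
     * sqnorm (x (lift ord0 i) - t (lift ord0 i))
  - sqnorm (barycenter lam x - barycenter lam t) / 2 <= residual lam phi x.
Proof.
move=> dx dt rt xt.
have /le_trans-> // : \sum_(i < m) lam (lift ord0 i) ^+ 2 / 2
     * sqnorm (x (lift ord0 i) - t (lift ord0 i))
  - sqnorm (barycenter lam x - barycenter lam t) / 2 <=
  residual lam phi x - residual lam phi t; last first.
  by rewrite gerDl oppr_le0 residual_ge0.
have bE : dot (barycenter lam t) (barycenter lam x - barycenter lam t) =
  \sum_(i < m) lam (lift ord0 i)
     * dot (barycenter lam t) (x (lift ord0 i) - t (lift ord0 i)).
  rewrite {2 3}/barycenter -sumrB big_ord_recl xt subrr add0r dot_sumr.
  by apply: eq_bigr => i _; rewrite -scalerBr dotZr.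
have : \sum_(i < m) (lam (lift ord0 i)
     * dot (barycenter lam t) (x (lift ord0 i) - t (lift ord0 i))
     + lam (lift ord0 i) ^+ 2 / 2
     * sqnorm (x (lift ord0 i) - t (lift ord0 i))) <=
  \sum_(i < m) ((lam (lift ord0 i) / 2 * sqnorm (x (lift ord0 i))
                 - phi (lift ord0 i) (x (lift ord0 i)))
               - (lam (lift ord0 i) / 2 * sqnorm (t (lift ord0 i))
                 - phi (lift ord0 i) (t (lift ord0 i)))).
  by apply: ler_sum => i _; exact: contact_strongly_convex.
rewrite big_split/= -bE [X in _ <= X -> _]sumrB !residualE !big_ord_recl xt.
have := sqnormD (barycenter lam t) (barycenter lam x - barycenter lam t).
by rewrite (addrC (barycenter lam t)) subrK => ->; lra.
Qed.

(** Passing from displacements of the coordinates to displacements of their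
    deviations from the tail mean costs, by the parallelogram inequality, the
    displacement of that mean, which is the one of the barycenter divided by
    [1 - lam ord0]; the weights [lam i ^+ 2] sum to at most
    [(1 - lam ord0) ^+ 2]. *)
Lemma residual_ge_tail_dev x t :
  tuple_dom S Y x -> tuple_dom S Y t -> residual lam phi t <= 0 ->
  x ord0 = t ord0 ->
  4^-1 * \sum_(i < m) lam (lift ord0 i) ^+ 2
           * sqnorm (tail_dev lam x i - tail_dev lam t i)
  - 3 / 2 * sqnorm (barycenter lam x - barycenter lam t) <= residual lam phi x.
Proof.
move=> dx dt rt xt; apply: le_trans (residual_ge_displacement dx dt rt xt).
set b := barycenter lam x - barycenter lam t.
pose a := 1 - lam ord0.
pose e := tail_mean lam x - tail_mean lam t.
have aE : a = \sum_(i < m) lam (lift ord0 i).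
  by rewrite /a -lam1 big_ord_recl addrAC subrr add0r.
have a_ge0 : 0 <= a by rewrite aE; apply: sumr_ge0 => i _; exact: ltW.
(* positive weights add up to 0 only when there is no tail *)
have [a0|a_neq0] := eqVneq a 0.
  have no_tail (F : 'I_m -> R) : \sum_(i < m) F i = 0.
    apply: big1 => i _; have := lam_gt0 (lift ord0 i).
    have /eqP := aE; rewrite a0 eq_sym psumr_eq0; last by move=> *; exact: ltW.
    by move=> /allP/(_ i)/(_ (mem_index_enum _))/eqP ->; rewrite ltxx.
  by rewrite !no_tail mulr0 !add0r; have := sqnorm_ge0 b; lra.
have ebE : sqnorm e * a ^+ 2 = sqnorm b.
  rewrite mulrC -sqnormZ /e /b /tail_mean /barycenter -/a scalerBr.
  rewrite !scalerA divff// !scale1r !big_ord_recl xt.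
  by rewrite [in RHS]opprD addrACA subrr add0r.
have sq_le : \sum_(i < m) lam (lift ord0 i) ^+ 2 <= a ^+ 2.
  rewrite expr2 {1}aE mulr_suml; apply: ler_sum => i _.
  rewrite expr2 ler_pM2l// aE (bigD1 i)//= lerDl.
  by apply: sumr_ge0 => j _; exact: ltW.
(* sqnorm d <= 2 * sqnorm (d + e) + 2 * sqnorm e, at the vector d - e *)
have : \sum_(i < m) lam (lift ord0 i) ^+ 2
         * sqnorm (tail_dev lam x i - tail_dev lam t i) <=
       \sum_(i < m) (4 * (lam (lift ord0 i) ^+ 2 / 2
         * sqnorm (x (lift ord0 i) - t (lift ord0 i)))
         + lam (lift ord0 i) ^+ 2 * (2 * sqnorm e)).
  apply: ler_sum => i _.
  set d := x (lift ord0 i) - t (lift ord0 i).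
  have -> : tail_dev lam x i - tail_dev lam t i = d - e.
    by rewrite /tail_dev opprD addrACA -opprD.
  have -> : forall A B C : R, 4 * (A / 2 * B) + A * (2 * C) = A * (2 * B + 2 * C).
    by move=> *; field.
  rewrite ler_pM2l ?exprn_gt0// sqnormD dotNr sqnormN.
  by have := sqnorm_ge0 (d + e); rewrite sqnormD; lra.
rewrite big_split/= -mulr_sumr -mulr_suml => h.
have : (\sum_(i < m) lam (lift ord0 i) ^+ 2) * (2 * sqnorm e) <= 2 * sqnorm b.
  rewrite -ebE mulrCA ler_pM2l// mulrC.
  by rewrite ler_wpM2l// sqnorm_ge0.
by have := sqnorm_ge0 b; lra.
Qed.

End Contact.

(** * Borel sets that meet the lines of one direction in at most one point *)

Section LebesgueNull.
Context (R : realType).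

(** The box formula makes Lebesgue measure sigma-finite, which Fubini needs. *)
Lemma lebesgue_rV_sigma_finite n : sigma_finite [set: 'rV[R]_n] (lebesgue_rV R n).
Proof.
pose box (q : nat) : set 'rV[R]_n :=
  [set v | forall i, v 0 i \in `[(const_mx (- q%:R) : 'rV[R]_n) 0 i,
                                 (const_mx q%:R : 'rV[R]_n) 0 i]%R].
exists box.
  apply/esym/seteqP; split=> // v _.
  exists (Num.truncn (\sum_(i < n) `|v 0 i|)).+1 => //= i.
  rewrite in_itv/= !mxE -ler_norml ltW//.
  apply: le_lt_trans (truncnS_gt _).
  by rewrite (bigD1 i)//= lerDl sumr_ge0.
move=> q; split.
  rewrite [X in measurable X](_ : _ = \bigcap_(i in [set: 'I_n])
    ((fun v : 'rV[R]_n => v 0 i) @^-1` [set` `[- q%:R : R, q%:R]])).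
    apply: fin_bigcap_measurable; first exact: finite_finset.
    move=> i _; rewrite -[X in measurable X]setTI.
    by apply: (@measurable_coord_rV R n i) => //; exact: measurable_itv.
  by apply/seteqP; split=> v /= h i; [move=> _|]; have := h i; rewrite !mxE//; exact.
rewrite lebesgue_rV_box ?ltry// => i.
by rewrite !mxE -subr_ge0 opprK addr_ge0.
Qed.

Let lebesgue_fun n : set 'rV[R]_n -> \bar R := lebesgue_rV R n.

HB.instance Definition _ n := Measure.copy (@lebesgue_fun n) (lebesgue_rV R n).

HB.instance Definition _ n := Measure_isSigmaFinite.Build _ _ _
  (@lebesgue_fun n) (lebesgue_rV_sigma_finite n).

Let lebesgue_sfinite n : {sigma_finite_measure set 'rV[R]_n -> \bar R} :=
  @lebesgue_fun n.

Lemma lebesgue_measure_subsingleton (A : set R) :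
  (forall s t, A s -> A t -> s = t) -> lebesgue_measure A = 0%E.
Proof.
move=> A1; have [->|/set0P[t At]] := eqVneq A set0; first exact: measure0.
rewrite (_ : A = [set t]) ?lebesgue_measure_set1//.
by apply/seteqP; split=> [s As|s ->//]; exact: A1.
Qed.

(** Fubini in the direction [k]. The measure is built by adjoining coordinates
    at the end, so when [k] is the last one its sections are points of the
    line, and otherwise the sections at a fixed last coordinate inherit the
    property. *)
Lemma lebesgue_rV_line_null n (k : 'I_n) (A : set 'rV[R]_n) : measurable A ->
  (forall v w, A v -> A w -> (forall j, j != k -> v 0 j = w 0 j) -> v = w) ->
  lebesgue_rV R n A = 0%E.
Proof.
elim: n k A => [[]//|n IH] k A mA A1.
pose A' := @rV_rcons R n @^-1` A.
have mA' : measurable A'.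
  by rewrite -[A']setTI; exact: measurable_rV_rcons.
have rconsE (v : 'rV[R]_n) (t : R) :
    (rV_rcons (v, t) 0 ord_max = t) *
    (forall j, rV_rcons (v, t) 0 (lift ord_max j) = v 0 j).
  by split=> [|j]; rewrite mxE ?unlift_none// liftK.
have -> : lebesgue_rV R n.+1 A = (lebesgue_rV R n \x @lebesgue_measure R)%E A'.
  by [].
case: (unliftP ord_max k) A1 => [k' ->|->] A1.
  rewrite (@product_measure_unique _ _ _ _ _ (lebesgue_sfinite n) lebesgue_measure
    (lebesgue_sfinite n \x^ @lebesgue_measure R)%E); last 2 first.
  - by move=> B C mB mC; exact: product_measure2E.
  - exact: mA'.
  apply: integral0_eq => t _ /=.
  apply: (IH k'); first exact: measurable_ysection.
  move=> v w; rewrite /ysection/= !inE /A'/= => Av Aw vw.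
  have vwE : rV_rcons (v, t) = rV_rcons (w, t).
    apply: A1 => // j; case: (unliftP ord_max j) => [j' ->|->] jk.
      by rewrite !rconsE; apply: vw; apply: contraNneq jk => ->.
    by rewrite !rconsE.
  by apply/rowP => j; have := congr1 (fun u : 'rV_n.+1 => u 0 (lift ord_max j)) vwE;
    rewrite !rconsE.
apply: integral0_eq => v _ /=.
apply: lebesgue_measure_subsingleton => s t.
rewrite /xsection/= !inE /A'/= => As At.
have stE : rV_rcons (v, s) = rV_rcons (v, t).
  apply: A1 => // j; case: (unliftP ord_max j) => [j' ->|->]; last by rewrite eqxx.
  by rewrite !rconsE.
by have := congr1 (fun u : 'rV_n.+1 => u 0 ord_max) stE; rewrite !rconsE.
Qed.

End LebesgueNull.

(** * Compactness of the contact tuples *)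

Section Continuity.
Context (R : realType) (n : nat).

Lemma barycenter_coord N (lam : 'I_N -> R) (x : 'I_N -> 'rV[R]_n) k :
  barycenter lam x 0 k = \sum_(i < N) lam i * x i 0 k.
Proof. by rewrite summxE; apply: eq_bigr => i _; rewrite mxE. Qed.

Lemma bary_cost_coord N (lam : 'I_N -> R) (x : 'I_N -> 'rV[R]_n) :
  \sum_(i < N) lam i = 1 ->
  bary_cost lam x = \sum_(i < N) lam i / 2 * \sum_(k < n) x i 0 k ^+ 2
    - 2^-1 * \sum_(k < n) (\sum_(i < N) lam i * x i 0 k) ^+ 2.
Proof.
move=> lam1; rewrite bary_cost_barycenter// (mulrC (sqnorm _)); congr (_ - _ * _).
by apply: eq_bigr => k _; rewrite barycenter_coord.
Qed.

Lemma continuous_sum (T : topologicalType) I (r : seq I) (F : I -> T -> R) :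
  (forall i, continuous (F i)) -> continuous (fun t => \sum_(i <- r) F i t).
Proof.
move=> cF; elim: r => [|i r IH] t.
  by under eq_fun do rewrite big_nil; exact: cst_continuous.
under eq_fun do rewrite big_cons.
by apply: continuousD; [exact: cF|exact: IH].
Qed.

Lemma continuous_sqr (T : topologicalType) (f : T -> R) :
  continuous f -> continuous (fun t => f t ^+ 2).
Proof.
move=> cf t; under eq_fun do rewrite expr2.
by apply: continuousM; exact: cf.
Qed.

Lemma continuous_scale (T : topologicalType) c (f : T -> R) :
  continuous f -> continuous (fun t => c * f t).
Proof.
move=> cf t; apply: (@continuousM _ _ (cst c) f); last exact: cf.
exact: cst_continuous.
Qed.

Lemma continuous_diff (T : topologicalType) (f g : T -> R) :
  continuous f -> continuous g -> continuous (fun t => f t - g t).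
Proof. by move=> cf cg t; apply: cvgB; [exact: cf|exact: cg]. Qed.

Lemma continuous_entry (T : topologicalType) (f : T -> 'rV[R]_n) k :
  continuous f -> continuous (fun t => f t 0 k).
Proof.
move=> cf t; apply: (@continuous_comp _ _ _ f (fun v : 'rV[R]_n => v 0 k)).
  exact: cf.
exact: coord_continuous.
Qed.

Lemma barycenter_continuous (T : topologicalType) N (lam : 'I_N -> R)
    (F : 'I_N -> T -> 'rV[R]_n) k :
  (forall i, continuous (F i)) -> continuous (fun t => barycenter lam (F^~ t) 0 k).
Proof.
move=> cF; under eq_fun do rewrite barycenter_coord.
apply: continuous_sum => i; apply: continuous_scale.
exact: continuous_entry.
Qed.

Lemma bary_cost_continuous (T : topologicalType) N (lam : 'I_N -> R)
    (F : 'I_N -> T -> 'rV[R]_n) : \sum_(i < N) lam i = 1 ->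
  (forall i, continuous (F i)) -> continuous (fun t => bary_cost lam (F^~ t)).
Proof.
move=> lam1 cF.
have ccoord i k : continuous (fun t => F i t 0 k) by exact: continuous_entry.
under eq_fun do rewrite bary_cost_coord//.
have c1 : continuous (fun t =>
    \sum_(i < N) lam i / 2 * \sum_(k < n) F i t 0 k ^+ 2).
  apply: continuous_sum => i; apply: continuous_scale.
  by apply: continuous_sum => k; apply: continuous_sqr; exact: ccoord.
have c2 : continuous (fun t =>
    2^-1 * \sum_(k < n) (\sum_(i < N) lam i * F i t 0 k) ^+ 2).
  apply: continuous_scale; apply: continuous_sum => k; apply: continuous_sqr.
  by apply: continuous_sum => i; apply: continuous_scale; exact: ccoord.
exact: continuous_diff c1 c2.
Qed.

Lemma closed_sublevel (T : topologicalType) (f : T -> R) c :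
  continuous f -> closed [set t | f t <= c].
Proof. by move=> /continuous_closedP/(_ _ (@closed_le _ c)). Qed.

End Continuity.

Section ContactSet.
Context (R : realType) (n m : nat) (lam : 'I_m.+1 -> R).
Context (S Y : set 'rV[R]_n) (phi : 'I_m.+1 -> 'rV[R]_n -> R).
Implicit Types i : 'I_m.+1.
Local Notation tuples := {ptws 'I_m.+1 -> 'rV[R]_n}.
Hypothesis lam1 : \sum_(i < m.+1) lam i = 1.
Hypothesis S_compact : compact S.
Hypothesis Y_compact : compact Y.
Hypothesis feasible : forall x : 'I_m.+1 -> 'rV[R]_n, tuple_dom S Y x ->
  \sum_(i < m.+1) phi i (x i) <= bary_cost lam x.
Hypothesis conjugate : c_conjugate lam S Y phi.

Definition contact_set (e : R) : set tuples :=
  [set x | tuple_dom S Y x /\ residual lam phi x <= e].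

Definition contact_shadow (e : R) (F : set tuples) : set 'rV[R]_n :=
  [set x ord0 | x in contact_set e `&` F].

Let coord_cont i : continuous (fun x : tuples => x i).
Proof. exact: (@proj_continuous _ (fun=> 'rV[R]_n) i). Qed.

Let factor_compact i : compact (tcons S (fun=> Y) i).
Proof. by rewrite /tcons; case: (unlift _ _). Qed.

Lemma tuple_dom_compact : compact (tuple_dom S Y : set tuples).
Proof.
exact: (@tychonoff _ (fun=> 'rV[R]_n) (fun i => tcons S (fun=> Y) i)).
Qed.

Lemma tuple_dom_closed : closed (tuple_dom S Y : set tuples).
Proof.
rewrite (_ : (tuple_dom S Y : set tuples) = \bigcap_(i in setT)
    ((fun x : tuples => x i) @^-1` tcons S (fun=> Y) i)); last first.
  by apply/seteqP; split=> x /= h i; [move=> _|]; exact: h.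
apply: closed_bigI => i _.
move/continuous_closedP : (@coord_cont i); apply.
by apply: compact_closed; [exact: norm_hausdorff|exact: factor_compact].
Qed.

Lemma conjugate_adherent i (x : tuples) e : 0 < e -> tuple_dom S Y x ->
  exists w, [/\ tuple_dom S Y w, w i = x i &
    bary_cost lam w - \sum_(j < m.+1 | j != i) phi j (w j) < phi i (x i) + e].
Proof.
move=> e0 dx; rewrite (conjugate (dx i)).
set E := [set _ | _ in _].
have infE : has_inf E.
  split; first by exists (bary_cost lam x
    - \sum_(j < m.+1 | j != i) phi j (x j)), x.
  exists (phi i (x i)) => _ [w [dw wi] <-].
  by rewrite lerBrDr -wi -(bigD1 i (P := predT))// feasible.
by have [_ [w [dw wi] <-] lt_e] := inf_adherent e0 infE; exists w.
Qed.

(** Each potential is an infimum of continuous functions, hence upper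
    semicontinuous. To see the residual as lower semicontinuous, the sum of
    the infima is written as one infimum over families [W], in which [W i]
    supplies the coordinates other than the [i]-th one in the [i]-th infimum. *)
Lemma contact_set_closed e : closed (contact_set e).
Proof.
pose g (W : 'I_m.+1 -> 'I_m.+1 -> 'rV[R]_n) i (x : tuples) :=
  bary_cost lam [eta W i with i |-> x i]
  - \sum_(j < m.+1 | j != i) phi j (W i j).
pose h W (x : tuples) := bary_cost lam x - \sum_(i < m.+1) g W i x.
have -> : contact_set e = (tuple_dom S Y : set tuples) `&`
    \bigcap_(W in [set W | forall i, tuple_dom S Y (W i)]) [set x | h W x <= e].
  apply/seteqP; split=> [x [dx xe]|x [dx xW]]; split=> //.
    move=> W /= dW; apply: le_trans xe; rewrite lerB// ler_sum// => i _.
    have := feasible (tuple_dom_update (dW i) (dx i)).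
    rewrite (bigD1 i)//= eqxx /g lerBrDr; congr (_ + _ <= _).
    by apply: eq_bigr => j /negPf ->.
  apply/ler_addgt0Pr => d d0.
  have d'0 : 0 < d / m.+1%:R by rewrite divr_gt0.
  have [W WP] := choice (fun i => conjugate_adherent i d'0 dx).
  have WE i : W i = [eta W i with i |-> x i].
    by apply/funext => j /=; case: eqP => // ->; have [] := WP i.
  have /xW : forall i, tuple_dom S Y (W i) by move=> i; have [] := WP i.
  rewrite /= -(lerD2r d); apply: le_trans; rewrite /h /residual -addrA lerD2l.
  rewrite -[in leRHS](opprK d) -opprD lerN2 lerBlDr.
  rewrite [X in _ + X](_ : d = \sum_(i < m.+1) d / m.+1%:R); last first.
    by rewrite sumr_const card_ord -[RHS]mulr_natr divfK// pnatr_eq0.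
  rewrite -big_split/=; apply: ler_sum => i _.
  by rewrite /g -WE ltW//; have [] := WP i.
apply: closedI; first exact: tuple_dom_closed.
apply: closed_bigI => W _; apply: closed_sublevel.
have c1 : continuous (fun x : tuples => bary_cost lam x).
  exact: (@bary_cost_continuous _ _ tuples _ lam (fun j y => y j)).
have c2 : continuous (fun x => \sum_(i < m.+1) g W i x).
  apply: continuous_sum => i; apply: continuous_diff; last exact: cst_continuous.
  apply: (@bary_cost_continuous _ _ tuples _ lam
    (fun j y => [eta W i with i |-> y i] j)) => // j /=.
  by case: eqP => _; [exact: coord_cont|exact: cst_continuous].
exact: continuous_diff c1 c2.
Qed.

Lemma contact_shadow_compact e F : closed F -> compact (contact_shadow e F).
Proof.
move=> cF; apply: continuous_compact.
  by apply: continuous_subspaceT => x; exact: coord_cont.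
apply: (@subclosed_compact tuples _ (tuple_dom S Y)).
- by apply: closedI => //; exact: contact_set_closed.
- exact: tuple_dom_compact.
- by move=> x [[]].
Qed.

Lemma contact_shadow_sub e F : contact_shadow e F `<=` S.
Proof. by move=> _ [x [[dx _] _] <-]; have := dx ord0; rewrite /tcons unlift_none. Qed.

(** Any cluster point of almost contact tuples with vanishing tolerances works. *)
Lemma contact_shadow0 F z : closed F ->
  (forall q : nat, contact_shadow q.+1%:R^-1 F z) -> contact_shadow 0 F z.
Proof.
move=> cF zF.
have /choice[x xP] : forall q : nat, exists y : tuples,
    contact_set q.+1%:R^-1 y /\ F y /\ y ord0 = z.
  by move=> q; have [y [? ?] ?] := zF q; exists y.
have [|p [_ p_cluster]] := @tuple_dom_compact (x @ \oo) _.
  by exists 0 => // q _; have [[]] := xP q.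
have limit_in (A : set tuples) : closed A -> (\forall q \near \oo, A (x q)) -> A p.
  by move=> cA xA; apply: cA => B pB; exact: p_cluster.
have pq q : contact_set q.+1%:R^-1 p.
  apply: limit_in; first exact: contact_set_closed.
  exists q => // k /= qk; have [[dx xk] _] := xP k; split=> //.
  by apply: le_trans xk _; rewrite lef_pV2 ?posrE// ler_nat.
exists p; last first.
  apply: (@limit_in [set y | y ord0 = z]).
    move/continuous_closedP : (@coord_cont ord0) => /(_ [set z]); apply.
    by apply: accessible_closed_set1; apply: hausdorff_accessible;
       exact: norm_hausdorff.
  by exists 0 => // q _; have [_ []] := xP q.
split; last by apply: limit_in => //; exists 0 => // q _; have [_ []] := xP q.
split; first by have [] := pq 0.
apply/ler_addgt0Pr => d d0; rewrite add0r.
have [_ /le_trans->//] := pq (Num.truncn d^-1).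
by rewrite -[leRHS]invrK lef_pV2 ?posrE ?invr_gt0// ltW// truncnS_gt.
Qed.

Lemma contact_shadow_total z : Y !=set0 -> S z -> contact_shadow 0 setT z.
Proof.
move=> [y0 Yy0] Sz; apply: contact_shadow0; first exact: closedT.
move=> q; have q0 : 0 < q.+1%:R^-1 :> R by rewrite invr_gt0.
have dz : tuple_dom S Y (@tcons _ m z (fun=> y0)).
  by move=> i; rewrite /tcons; case: (unlift ord0 i).
have [w [dw wz wq]] := conjugate_adherent ord0 q0 dz.
exists w => //; last by rewrite wz /tcons unlift_none.
split=> //; split=> //; rewrite /residual (bigD1 ord0)//= wz.
by rewrite opprD addrA addrAC lerBlDl ltW.
Qed.

End ContactSet.

(** * Probability measures carried by a set, and their images *)

Section ProbabilityTransport.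
Context (R : realType) (n : nat).
Local Notation V := 'rV[R]_n.

Lemma closed_measurable_rV (C : set V) : closed C -> measurable C.
Proof.
move=> cC; rewrite -[C]setCK; apply: measurableC.
by apply: open_measurable_rV; exact: closed_openC.
Qed.

Lemma probability_full d (T : measurableType d) (P : probability T R) (S A : set T) :
  measurable S -> P S = 1%E -> measurable A -> P (S `&` A) = P A.
Proof.
move=> mS PS mA; rewrite [RHS](measureDI P mA mS) setIC [X in _ = (X + _)%E](_ : _ = 0%E).
  by rewrite add0e.
apply: (@subset_measure0 _ _ _ P _ (~` S)).
- exact: measurableD.
- exact: measurableC.
- by move=> x [].
- by apply: etrans (probability_setC _ mS) _; rewrite PS subee.
Qed.

(** Cutting the map off outside [S], a null set for [P], makes it globally
    measurable, so that its law is available; that law is [Q]. *)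
Lemma integral_transport (P Q : probability V R) (S Y : set V) (t : V -> V)
    (f : V -> R) :
  measurable S -> measurable Y -> P S = 1%E ->
  (forall x, S x -> Y (t x)) -> measurable_fun S t ->
  (forall A, measurable A -> P (S `&` t @^-1` A) = Q A) ->
  Q.-integrable Y (EFin \o f) ->
  P.-integrable S (EFin \o (f \o t)) /\
  (\int[Q]_(y in Y) (f y)%:E = \int[P]_(x in S) (f (t x))%:E)%E.
Proof.
move=> mS mY PS tY mt PQ iQ.
pose t0 := t \_ S.
have mt0 : measurable_fun setT t0.
  by apply/(measurable_restrict _ mS measurableT); rewrite setTI.
pose g := (EFin \o f) \_ Y.
have iQg : Q.-integrable setT g by apply/(integrable_mkcond _ mY).
have mg : measurable_fun setT g by have /integrableP[] := iQg.
pose X : {mfun V >-> V} := HB.pack t0 (isMeasurableFun.Build _ _ _ _ _ mt0).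
have lawE A : measurable A -> distribution P X A = Q A.
  move=> mA; rewrite -PQ// -[LHS](@probability_full _ _ P S)//; last first.
    by rewrite -[X in measurable X]setTI; exact: measurable_funP X measurableT _ mA.
  by congr (P _); apply/seteqP; split=> x [Sx /=]; rewrite /t0 patchT ?inE.
have lawI (h : V -> \bar R) : (\int[Q]_y h y = \int[distribution P X]_y h y)%E.
  by apply: eq_measure_integral => A mA _; apply: esym; exact: lawE.
have iPg : P.-integrable setT (g \o t0).
  apply/integrableP; split; first exact: measurableT_comp.
  have /integrableP[_] := iQg; apply: le_lt_trans.
  by rewrite lawI ge0_integral_distribution//; exact: measurableT_comp.
have gtE : {in S, g \o t0 =1 EFin \o (f \o t)}.
  move=> x xS; rewrite /= /t0 /g patchT// patchT//.
  by rewrite inE; apply: tY; rewrite inE in xS.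
split.
  by apply: (eq_integrable mS (g \o t0)) => //; exact: integrableS iPg.
rewrite integral_mkcond -/g lawI integral_distribution//.
rewrite (negligible_integral (measurableC mS))//.
  by rewrite setDE setCK setTI; exact: eq_integral.
by apply: etrans (probability_setC _ mS) _; rewrite PS subee.
Qed.

(** Every open set is an increasing union of closed sets, namely of the sets of
    points whose ball of radius [q.+1%:R^-1] stays inside. Hence a comparison on
    closed sets propagates to open sets in the opposite direction, and two
    probabilities with comparable values on closed sets agree. *)
Lemma probability_eq_closed (P Q : probability V R) :
  (forall C : set V, closed C -> (P C <= Q C)%E) ->
  forall A : set V, measurable A -> P A = Q A.
Proof.
move=> PQ.
have PQo (U : set V) : open U -> (P U <= Q U)%E.
  move=> oU.
  pose F (q : nat) : set V := ~` \bigcup_(w in ~` U) ball w q.+1%:R^-1.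
  have cF q : closed (F q).
    by apply: open_closedC; apply: bigcup_open => w _; exact: ball_open.
  have UE : U = \bigcup_q F q.
    apply/seteqP; split=> [v Uv|v [q _ Fv]]; last first.
      apply: contrapT => Uv; apply: Fv; exists v => //; exact: ballxx.
    have /nbhs_ballP[e /= e0 eU] := open_nbhs_nbhs (conj oU Uv).
    exists (Num.truncn e^-1) => //= -[w Uw vw]; apply: Uw; apply: eU.
    apply: ball_sym; apply: le_ball vw.
    by rewrite -[leRHS]invrK lef_pV2 ?posrE ?invr_gt0// ltW// truncnS_gt.
  have ndF : {homo F : a b / (a <= b)%N >-> (a <= b)%O}.
    move=> a b ab; apply/subsetPset; apply: subsetC.
    apply: subset_bigcup => w _; apply: le_ball.
    by rewrite lef_pV2 ?posrE// ler_nat.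
  have mF q : measurable (F q) by exact: closed_measurable_rV.
  have mU : measurable (\bigcup_q F q) by rewrite -UE; exact: open_measurable_rV.
  have PF := nondecreasing_cvg_mu (mu := P) mF mU ndF.
  have QF := nondecreasing_cvg_mu (mu := Q) mF mU ndF.
  rewrite UE -(cvg_lim _ PF)// -(cvg_lim _ QF)//.
  apply: lee_lim; [by apply: cvgP PF|by apply: cvgP QF|].
  by apply: nearW => q; exact: PQ.
have PQoE (U : set V) : open U -> P U = Q U.
  move=> oU; apply/le_anti; rewrite PQo//=.
  have mU := open_measurable_rV oU.
  have := PQ _ (open_closedC oU); rewrite !probability_setC//.
  rewrite -(fineK (fin_num_measure P _ mU)) -(fineK (fin_num_measure Q _ mU)).
  by rewrite -!EFinB !lee_fin lerD2l lerN2.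
move=> A mA; apply: (measure_unique (@open V) (fun=> setT)) => //.
- by move=> B C; exact: openI.
- by move=> _; exact: openT.
- by rewrite bigcup_const//; exists 0%N.
- by move=> _; rewrite -ge0_fin_numE ?fin_num_measure.
Qed.

End ProbabilityTransport.

(** * Cost, residual and dual value along admissible maps *)

Section NoGap.
Context (R : realType) (n m : nat) (lam : 'I_m.+1 -> R).
Local Notation V := 'rV[R]_n.
Local Notation tuples := {ptws 'I_m.+1 -> 'rV[R]_n}.
Context (S Y : set V) (rho : probability V R) (mu : 'I_m -> probability V R).
Context (phi : 'I_m.+1 -> V -> R).
Hypothesis lam_gt0 : forall i, 0 < lam i.
Hypothesis lam1 : \sum_(i < m.+1) lam i = 1.
Hypothesis S_compact : compact S.
Hypothesis Y_compact : compact Y.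
Hypothesis rhoS : rho S = 1%E.
Hypothesis phi_feasible : dual_feasible lam S Y rho mu phi.

Lemma graph_tuple_dom (T : 'I_m -> V -> V) x : S x -> (forall i, Y (T i x)) ->
  tuple_dom S Y (graph_tuple T x).
Proof.
move=> Sx Tx i; rewrite /graph_tuple /tcons.
by case: (unlift ord0 i) => [j|] /=; [exact: Tx|].
Qed.

Lemma bary_cost_bounded :
  exists M, forall x, tuple_dom S Y x -> `|bary_cost lam x| <= M.
Proof.
have cont : continuous (fun x : tuples => bary_cost lam x).
  apply: (@bary_cost_continuous _ _ tuples _ lam (fun j y => y j)) => // i.
  exact: (@proj_continuous _ (fun=> V) i).
have : compact [set bary_cost lam x | x in (tuple_dom S Y : set tuples)].
  apply: continuous_compact; first exact: continuous_subspaceT.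
  exact: tuple_dom_compact.
move=> /(@compact_bounded _ R^o)[M [_ /(_ (M + 1))]].
rewrite ltrDl ltr01 => /(_ isT) bM; exists (M + 1) => x dx.
by apply: bM; exists x.
Qed.

(** The dual value is unchanged by transport, so the cost of any admissible
    maps exceeds it by the integral of the residual along their graph. *)
Lemma transport_cost_residual T : transport_maps S Y rho mu T ->
  rho.-integrable S (EFin \o (fun x => residual lam phi (graph_tuple T x))) /\
  (\int[rho]_(x in S) (residual lam phi (graph_tuple T x))%:E =
   transport_cost lam S rho T - dual_value S Y rho mu phi)%E.
Proof.
move=> trT; have [phi_int _] := phi_feasible.
have mS := compact_measurable_rV S_compact.
have mY := compact_measurable_rV Y_compact.
have gS i x : graph_tuple T x (lift ord0 i) = T i x by rewrite /graph_tuple /tcons liftK.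
have g0 x : graph_tuple T x ord0 = x by rewrite /graph_tuple /tcons unlift_none.
have phiT i : rho.-integrable S (EFin \o (fun x => phi i (graph_tuple T x i))) /\
    (\int[rho]_(x in S) (phi i (graph_tuple T x i))%:E =
     \int[tcons rho mu i]_(v in tcons S (fun=> Y) i) (phi i v)%:E)%E.
  have := phi_int i; case: (unliftP ord0 i) => [j ->|->].
    rewrite /tcons liftK /= => iphi; have [TY mT TE] := trT j.
    have [iphiT ->] := integral_transport mS mY rhoS TY mT TE iphi.
    split; last by apply: eq_integral => x _; rewrite gS.
    by apply: eq_integrable iphiT => // x _; rewrite /= gS.
  rewrite /tcons unlift_none /= => iphi.
  split; last by apply: eq_integral => x _; rewrite g0.
  by apply: eq_integrable iphi => // x _; rewrite /= g0.
have mc : measurable_fun S (fun x => bary_cost lam (graph_tuple T x)).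
  have mcoord i k : measurable_fun S (fun x => graph_tuple T x i 0 k).
    apply: (measurableT_comp (@measurable_coord_rV R n k)).
    case: (unliftP ord0 i) => [j ->|->].
      by under eq_fun do rewrite gS; have [_ ? _] := trT j.
    by under eq_fun do rewrite g0; exact: measurable_id.
  under eq_fun do rewrite bary_cost_coord//.
  apply: measurable_funB.
    apply: measurable_sum => i; apply: measurable_funM => //.
    by apply: measurable_sum => k; apply: measurable_funX.
  apply: measurable_funM => //; apply: measurable_sum => k; apply: measurable_funX.
  by apply: measurable_sum => i; apply: measurable_funM.
have ic : rho.-integrable S (EFin \o (fun x => bary_cost lam (graph_tuple T x))).
  apply: measurable_bounded_integrable => //.
    by rewrite -ge0_fin_numE// fin_num_measure.
  have [M bM] := bary_cost_bounded; exists M; split; first exact: num_real.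
  move=> r /ltW Mr x Sx; apply: le_trans Mr; apply: bM.
  by apply: graph_tuple_dom => // i; have [TY _ _] := trT i; exact: TY.
have iphi : rho.-integrable S
    (EFin \o (fun x => \sum_(i < m.+1) phi i (graph_tuple T x i))).
  have := integrable_sum mS (index_enum 'I_m.+1) (P := xpredT)
    (fun i _ => (phiT i).1).
  by apply: eq_integrable => // x _; rewrite /= sumEFin.
split.
  have := integrableB mS ic iphi.
  by apply: eq_integrable => // x _; rewrite /= EFinB.
rewrite /transport_cost /dual_value.
under [in RHS]eq_bigr do rewrite -(phiT _).2.
rewrite -integral_sum//; last by move=> i; have [] := phiT i.
rewrite -integralB//.
- by apply: eq_integral => x _; rewrite sumEFin -EFinB.
- by under eq_fun do rewrite sumEFin.
Qed.

End NoGap.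

(** * The map carried by the contact set *)

Section DualMap.
Context (R : realType) (n m : nat) (lam : 'I_m.+1 -> R).
Local Notation V := 'rV[R]_n.
Local Notation tuples := {ptws 'I_m.+1 -> 'rV[R]_n}.
Context (S Y : set V) (rho : probability V R) (mu : 'I_m -> probability V R).
Context (phi : 'I_m.+1 -> V -> R) (y0 : V).
Hypothesis lam_gt0 : forall i, 0 < lam i.
Hypothesis lam1 : \sum_(i < m.+1) lam i = 1.
Hypothesis S_compact : compact S.
Hypothesis Y_compact : compact Y.
Hypothesis rhoS : rho S = 1%E.
Hypothesis rho_ac : rho `<< lebesgue_rV R n.
Hypothesis Yy0 : Y y0.
Hypothesis phi_opt : kantorovich_potentials lam S Y rho mu phi.

Let feasible : forall x : 'I_m.+1 -> V, tuple_dom S Y x ->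
  \sum_(i < m.+1) phi i (x i) <= bary_cost lam x.
Proof. by case: phi_opt => -[]. Qed.

Let conjugate : c_conjugate lam S Y phi.
Proof. by case: phi_opt. Qed.

Local Notation contact := (contact_set lam S Y phi).
Local Notation shadow := (contact_shadow lam S Y phi).

Let coord_cont (i : 'I_m.+1) : continuous (fun x : tuples => x i).
Proof. exact: (@proj_continuous _ (fun=> V) i). Qed.

Let shadow_compact e F : closed F -> compact (shadow e F).
Proof. exact: contact_shadow_compact. Qed.

Let shadow_measurable e F : closed F -> measurable (shadow e F).
Proof. by move=> cF; apply: compact_measurable_rV; exact: shadow_compact. Qed.

(** Distinct barycenters are separated by a rational gap in some coordinate, so
    these countably many compact sets exhaust the points above which the contact
    barycenter is not unique. *)
Definition branch k (q : rat * rat) : set V :=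
  shadow 0 [set x | barycenter lam x 0 k <= ratr q.1] `&`
  shadow 0 [set x | ratr q.2 <= barycenter lam x 0 k].

Definition branch_set : set V :=
  \bigcup_j oapp (fun p : 'I_n * (rat * rat) =>
                    if p.2.1 < p.2.2 then branch p.1 p.2 else set0)
                 set0 (unpickle j).

Let barycenter_cont k : continuous (fun x : tuples => barycenter lam x 0 k).
Proof. exact: (@barycenter_continuous _ _ tuples _ lam (fun j y => y j)). Qed.

Lemma branch_measurable k q : measurable (branch k q).
Proof.
apply: measurableI; apply: shadow_measurable.
  exact: closed_sublevel.
by move/continuous_closedP : (@barycenter_cont k) => /(_ _ (@closed_ge _ (ratr q.2))).
Qed.

(** By [contact_monotone], moving forward along a line of direction [k] cannot take
    the [k]-th coordinate of the barycenter from above a gap to below it. *)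
Lemma branch_line k q v w : q.1 < q.2 -> branch k q v -> branch k q w ->
  (forall j, j != k -> v 0 j = w 0 j) -> v = w.
Proof.
move=> q12.
suff wlog_le v' w' : branch k q v' -> branch k q w' ->
    (forall j, j != k -> v' 0 j = w' 0 j) -> v' 0 k <= w' 0 k -> v' = w'.
  move=> bv bw vw; have [|/ltW] := leP (v 0 k) (w 0 k); first exact: wlog_le.
  by move=> wv; apply/esym/wlog_le => // j jk; rewrite vw.
move=> [_ [x [[dx rx] /= xq2] <-]] [[x' [[dx' rx'] /= xq1] <-] _] xx' lex.
have := contact_monotone lam_gt0 lam1 feasible ord0 dx rx dx' rx'.
rewrite [dot _ _](bigD1 k)//= big1 ?addr0; last first.
  by move=> j jk; rewrite !mxE xx'// subrr mulr0.
rewrite !mxE => le_gap; apply/esym/eqP; rewrite -subr_eq0; apply/eqP/sqnorm_le0.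
rewrite -(pmulr_rle0 _ (lam_gt0 ord0)); apply: le_trans le_gap _.
rewrite mulr_le0_ge0 ?subr_ge0// subr_le0; apply: le_trans xq1 _.
by apply: le_trans xq2; rewrite ler_rat ltW.
Qed.

Lemma branch_set_measurable : measurable branch_set.
Proof.
apply: bigcupT_measurable => j; case: unpickle => //= p.
by case: ifP => // _; exact: branch_measurable.
Qed.

Lemma branch_set_null : rho branch_set = 0%E.
Proof.
apply: (measure_negligible branch_set_measurable).
apply: negligible_bigcup => j.
case: unpickle => [p|] /=; last exact: negligible_set0.
case: ifP => [p12|_]; last exact: negligible_set0.
apply/negligibleP; first exact: branch_measurable.
have /null_content_dominatesP := rho_ac; apply; first exact: branch_measurable.
apply: (lebesgue_rV_line_null (k := p.1)); first exact: branch_measurable.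
by move=> v w; exact: branch_line.
Qed.

Lemma contact_unique x x' : contact 0 x -> contact 0 x' -> x ord0 = x' ord0 ->
  ~ branch_set (x ord0) -> x = x'.
Proof.
move=> cx cx' xx' nbr.
have [dx rx] := cx; have [dx' rx'] := cx'.
apply: (contact_barycenter_inj lam_gt0 lam1 feasible dx rx dx' rx').
(* r < s are rationals between the two barycenters in coordinate k *)
have gap_branch y y' k : contact 0 y -> contact 0 y' -> y ord0 = y' ord0 ->
    barycenter lam y 0 k < barycenter lam y' 0 k -> branch_set (y ord0).
  move=> cy cy' yy' yk.
  have [s] := rat_in_itvoo yk; rewrite in_itv/= => /andP[ys sy'].
  have [r] := rat_in_itvoo ys; rewrite in_itv/= => /andP[yr rs].
  exists (pickle (k, (r, s))) => //; rewrite pickleK/= -(ltr_rat R) rs.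
  split; first by exists y => //; split=> //=; exact: ltW.
  by exists y' => //; split=> //=; exact: ltW.
apply/rowP => k; apply: contrapT => /eqP; rewrite neq_lt => /orP[] h.
  by apply: nbr; exact: gap_branch h.
by apply: nbr; rewrite xx'; exact: gap_branch h.
Qed.

(** Choosing the constant [y0] off [S `\` branch_set] keeps the map measurable and
    with values in [Y]. *)
Definition dual_map (i : 'I_m) (z : V) : V :=
  if z \in S `\` branch_set then
    (xget (fun=> y0) [set x : tuples | contact 0 x /\ x ord0 = z]) (lift ord0 i)
  else y0.

Lemma dual_map_contact z : S z -> ~ branch_set z ->
  contact 0 (graph_tuple dual_map z).
Proof.
move=> Sz bz.
have [x [cx _] xz] : shadow 0 setT z.
  by apply: contact_shadow_total => //; exists y0.
have [cg gz] := xgetPex (fun=> y0)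
  (ex_intro [set x : tuples | contact 0 x /\ x ord0 = z] x (conj cx xz)).
rewrite (_ : graph_tuple dual_map z =
  xget (fun=> y0) [set x : tuples | contact 0 x /\ x ord0 = z])//.
apply/funext => i; rewrite /graph_tuple /tcons.
case: (unliftP ord0 i) => [j ->|->] /=; last by rewrite gz.
by rewrite /dual_map mem_set.
Qed.

Lemma dual_map_shadow i (C : set V) z : S z -> ~ branch_set z ->
  C (dual_map i z) <-> shadow 0 [set x : tuples | C (x (lift ord0 i))] z.
Proof.
move=> Sz bz; have cz := dual_map_contact Sz bz.
have gE : graph_tuple dual_map z ord0 = z by rewrite /graph_tuple /tcons unlift_none.
have giE : graph_tuple dual_map z (lift ord0 i) = dual_map i z.
  by rewrite /graph_tuple /tcons liftK.
split=> [Cz|[x [cx Cx] xz]].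
  by exists (graph_tuple dual_map z) => //; split=> //=; rewrite giE.
by rewrite -giE -(contact_unique cx cz) ?gE ?xz.
Qed.

Lemma dual_map_Y i z : S z -> Y (dual_map i z).
Proof.
move=> Sz; have [bz|bz] := pselect (branch_set z).
  by rewrite /dual_map memNset// => -[].
have [/(_ (lift ord0 i)) + _] := dual_map_contact Sz bz.
by rewrite /graph_tuple /tcons liftK.
Qed.

Let closed_coord i (C : set V) : closed C -> closed [set x : tuples | C (x i)].
Proof. by move=> cC; move/continuous_closedP : (@coord_cont i); apply. Qed.

Lemma dual_map_measurable i : measurable_fun setT (dual_map i).
Proof.
have mS := compact_measurable_rV S_compact.
have mclosed (C : set V) : closed C -> measurable (dual_map i @^-1` C).
  move=> cC.
  rewrite (_ : _ @^-1` _ =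
    (shadow 0 [set x : tuples | C (x (lift ord0 i))] `\` branch_set) `|`
    (if `[< C y0 >] then ~` (S `\` branch_set) else set0)); last first.
    apply/seteqP; split=> z /=.
      have [[Sz bz]|nz] := pselect ((S `\` branch_set) z).
        by move=> /(dual_map_shadow i _ Sz bz); left.
      by rewrite /dual_map memNset// => /asboolP ->; right.
    move=> [[sz bz]|].
      by apply/(dual_map_shadow i) => //; exact: contact_shadow_sub sz.
    by case: asboolP => // Cy0 nz; rewrite /dual_map memNset.
  have mbr := branch_set_measurable.
  apply: measurableU.
    by apply: measurableD => //; apply: shadow_measurable; exact: closed_coord.
  by case: ifP => // _; apply: measurableC; exact: measurableD.
move=> mT; apply: (@measurability _ _ _ _ _ _ (@open V)) => //.
move=> _ [U oU <-]; rewrite setTI -[U]setCK preimage_setC.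
by apply: measurableC; exact: mclosed (open_closedC oU).
Qed.

(** First variation of the dual value: raising [phi (lift ord0 i)] by [e] on [C]
    breaks the constraint only at tuples that are in contact up to [e], so
    lowering [phi ord0] by [e] on the shadow of these tuples restores it.
    Optimality says that the exchange does not pay. *)
Lemma closed_mass_le_shadow i (C : set V) e : 0 < e -> closed C ->
  (mu i (Y `&` C) <= rho (shadow e [set x : tuples | C (x (lift ord0 i))]))%E.
Proof.
move=> e0 cC; set D := shadow e _.
have mS := compact_measurable_rV S_compact.
have mY := compact_measurable_rV Y_compact.
have mC := closed_measurable_rV cC.
have mD : measurable D by apply: shadow_measurable; exact: closed_coord.
pose w : 'I_m.+1 -> V -> R :=
  tcons (fun v => -1 * \1_D v) (fun i' v => (i' == i)%:R * \1_C v).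
pose psi j v := phi j v + e * w j v.
have [[phi_int _] phi_max _] := phi_opt.
have int1 (P : probability V R) (A B : set V) : measurable A -> measurable B ->
    P.-integrable B (EFin \o \1_A).
  by move=> mA mB; apply: (integrableS measurableT) => //; exact: integrable_indic.
have mdom (j : 'I_m.+1) : measurable (tcons S (fun=> Y) j : set V).
  by case: (unliftP ord0 j) => [j' ->|->]; rewrite /tcons ?liftK ?unlift_none.
pose W j : \bar R := tcons ((-1)%:E * rho (D `&` S))%E
  (fun i' => (i' == i)%:R%:E * mu i' (C `&` Y))%E j.
have w_int j : (tcons rho mu j).-integrable (tcons S (fun=> Y) j) (EFin \o w j) /\
    (\int[tcons rho mu j]_(v in tcons S (fun=> Y) j) (w j v)%:E = W j)%E.
  rewrite /w /W; case: (unliftP ord0 j) => [j' ->|->];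
    rewrite /tcons ?liftK ?unlift_none/=.
    split; first exact: (integrableZl mY (j' == i)%:R (int1 _ _ _ mC mY)).
    rewrite -integral_indic// -integralZl//; exact: int1.
  split; first exact: (integrableZl mS (-1) (int1 _ _ _ mD mS)).
  rewrite -integral_indic// -integralZl//; exact: int1.
have psi_int j : (tcons rho mu j).-integrable (tcons S (fun=> Y) j) (EFin \o psi j).
  have [wj _] := w_int j.
  have := integrableD (mdom j) (phi_int j) (integrableZl (mdom j) e wj).
  by apply: eq_integrable.
have psi_feasible : dual_feasible lam S Y rho mu psi.
  split=> // x dx; rewrite big_split/= -mulr_sumr.
  have -> : \sum_(j < m.+1) w j (x j) = \1_C (x (lift ord0 i)) - \1_D (x ord0).
    rewrite big_ord_recl {1}/w /tcons unlift_none /= mulN1r addrC.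
    congr (_ - _); rewrite (bigD1 i)//= big1 ?addr0.
      by rewrite /w /tcons liftK /= eqxx mul1r.
    by move=> j /negPf ji; rewrite /w /tcons liftK /= ji mul0r.
  (* over D both changes cancel or the sum decreases; elsewhere a tuple with
     its coordinate in C has residual at least e *)
  have [xD|xD] := pselect (D (x ord0)).
    rewrite [\1_D _]indicE mem_set// (le_trans _ (feasible dx))// gerDl.
    by rewrite pmulr_rle0// subr_le0 indicE lern1 leq_b1.
  rewrite [\1_D _]indicE memNset// subr0 indicE.
  have [xC|xC] := pselect (C (x (lift ord0 i))); last first.
    by rewrite memNset// mulr0 addr0 feasible.
  rewrite mem_set// mulr1 -lerBrDl; apply: contrapT => /negP.
  rewrite -ltNge => lt_e; apply: xD; exists x => //; split=> //; split=> //.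
  exact: ltW.
have dual_fin : dual_value S Y rho mu phi \is a fin_num.
  by rewrite /dual_value; apply/sum_fin_numP => j _ _; exact: integrable_fin_num (phi_int j).
have := phi_max _ psi_feasible.
rewrite [X in (X <= _)%E](_ : _ =
    dual_value S Y rho mu phi + \sum_(j < m.+1) e%:E * W j)%E; last first.
  rewrite /dual_value -big_split/=; apply: eq_bigr => j _.
  have [wj <-] := w_int j; rewrite -integralZl//.
  by rewrite -(integralD (mdom j) (phi_int j) (integrableZl (mdom j) e wj)).
rewrite -leeBrDl// subee// big_ord_recl (bigD1 i)//= big1 ?adde0; last first.
  by move=> j /negPf ji; rewrite /W /tcons liftK /= ji mul0e mule0.
rewrite /W /tcons unlift_none liftK /= eqxx mul1e.
rewrite (setIC C) setIidl; last exact: contact_shadow_sub.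
rewrite -(fineK (fin_num_measure rho _ mD)).
rewrite -(fineK (fin_num_measure (mu i) _ (measurableI _ _ mY mC))).
rewrite mulN1e -EFinN -!EFinM -EFinD !lee_fin -mulrDr pmulr_rle0// addrC subr_le0.
by [].
Qed.

(** As the tolerance vanishes the shadows of [C] shrink to the shadow of exact
    contact, which up to a null set is the preimage of [C] under [dual_map]. *)
Lemma dual_map_mass i (A : set V) : mu i Y = 1%E -> measurable A ->
  rho (S `&` dual_map i @^-1` A) = mu i A.
Proof.
move=> muY mA.
have mS := compact_measurable_rV S_compact.
have mY := compact_measurable_rV Y_compact.
have mbr := branch_set_measurable.
pose X : {mfun V >-> V} :=
  HB.pack (dual_map i) (isMeasurableFun.Build _ _ _ _ _ (dual_map_measurable i)).
have mX B : measurable B -> measurable (dual_map i @^-1` B).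
  by move=> mB; rewrite -[X in measurable X]setTI;
     exact: measurable_funP X measurableT _ mB.
rewrite (probability_full mS rhoS (mX _ mA)).
suff /(_ A mA) -> : forall B, measurable B -> mu i B = distribution rho X B by [].
apply: probability_eq_closed => C cC.
have mC := closed_measurable_rV cC.
rewrite -(probability_full mY muY mC).
pose F : set tuples := [set x | C (x (lift ord0 i))].
have cF : closed F by exact: closed_coord.
pose D (q : nat) := shadow q.+1%:R^-1 F.
have mD q : measurable (D q) by exact: shadow_measurable.
have mDI : measurable (\bigcap_q D q) by exact: bigcapT_measurable.
have niD : {homo D : a b / (a <= b)%N >-> (b <= a)%O}.
  move=> a b ab; apply/subsetPset => _ [x [[dx xb] Fx] <-]; exists x => //.
  by split=> //; split=> //; apply: le_trans xb _; rewrite lef_pV2 ?posrE// ler_nat.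
have D0 : (rho (D 0%N) < +oo)%E by rewrite -ge0_fin_numE// fin_num_measure.
have D_cvg := nonincreasing_cvg_mu (mu := rho) D0 mD mDI niD.
have : (mu i (Y `&` C) <= rho (\bigcap_q D q))%E.
  rewrite -(cvg_lim _ D_cvg)//; apply: lime_ge; first by apply: cvgP D_cvg.
  by apply: nearW => q; apply: closed_mass_le_shadow.
move/le_trans; apply.
have -> : rho (\bigcap_q D q) = rho (\bigcap_q D q `\` branch_set).
  rewrite (measureDI rho mDI mbr) [X in (_ + X)%E](_ : _ = 0%E) ?adde0//.
  apply: (@subset_measure0 _ _ _ rho _ branch_set) => //.
  - exact: measurableI.
  - exact: branch_set_null.
apply: le_measure; rewrite ?inE; [exact: measurableD|exact: mX|].
move=> z [Dz bz].
have sz : shadow 0 F z by apply: contact_shadow0 => // q; exact: Dz.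
by apply/(dual_map_shadow i) => //; exact: contact_shadow_sub sz.
Qed.

(** The maps carried by the contact set have zero residual almost everywhere, so
    their cost is the dual value. Optimal maps cost no more, while their residual
    is nonnegative; its integral, hence the residual itself, vanishes. *)
Lemma optimal_maps_contact T : (forall i, mu i Y = 1%E) ->
  optimal_maps lam S Y rho mu T ->
  {ae rho, forall x, S x -> residual lam phi (graph_tuple T x) = 0}.
Proof.
move=> muY [trT optT]; have [phi_feasible _ _] := phi_opt.
have mS := compact_measurable_rV S_compact.
have tr_dual : transport_maps S Y rho mu dual_map.
  move=> i; split; first by move=> x; exact: dual_map_Y.
    by apply: measurable_funTS; exact: dual_map_measurable.
  by move=> A mA; exact: dual_map_mass.
have res_ge0 U x : transport_maps S Y rho mu U -> S x ->
    0 <= residual lam phi (graph_tuple U x).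
  move=> trU Sx; apply: (residual_ge0 feasible); apply: graph_tuple_dom => // i.
  by have [UY _ _] := trU i; exact: UY.
have cost_res := transport_cost_residual lam1 S_compact Y_compact rhoS phi_feasible.
have [dual_int dualE] := cost_res _ tr_dual.
have [res_int resE] := cost_res _ trT.
have dual0 :
    (\int[rho]_(x in S) (residual lam phi (graph_tuple dual_map x))%:E = 0)%E.
  rewrite (negligible_integral branch_set_measurable mS dual_int branch_set_null).
  apply: integral0_eq => x [Sx bx]; congr EFin; apply/le_anti.
  by rewrite res_ge0// andbT; have [] := dual_map_contact Sx bx.
have res0 : (\int[rho]_(x in S) (residual lam phi (graph_tuple T x))%:E = 0)%E.
  apply/le_anti/andP; split; last first.
    by apply: integral_ge0 => x Sx; rewrite lee_fin res_ge0.
  by rewrite -dual0 dualE resE leeB// optT.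
have /integrableP[mres _] := res_int.
have /(ae_eq_integral_abs _ mS mres) : (\int[rho]_(x in S)
    `|(EFin \o (fun x => residual lam phi (graph_tuple T x))) x| = 0)%E.
  rewrite -res0; apply: eq_integral => x; rewrite inE => Sx /=.
  by rewrite ger0_norm// res_ge0.
by apply: filterS => x h Sx; have [] := h Sx.
Qed.

End DualMap.

(** * The stability estimate *)

Theorem proposition2p3 (R : realType) (n m : nat) (hN : (3 <= m.+1)%N)
    (lam : 'I_m.+1 -> R) (hlam : forall i, 0 < lam i)
    (hlam1 : \sum_(i < m.+1) lam i = 1)
    (S Y : set 'rV[R]_n) (hS : compact S) (hY : compact Y)
    (rho : probability 'rV[R]_n R) (hrhoS : rho S = 1%E)
    (hrho : rho `<< lebesgue_rV R n)
    (mu : 'I_m -> probability 'rV[R]_n R) (hmuY : forall i, mu i Y = 1%E)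
    (T : 'I_m -> 'rV[R]_n -> 'rV[R]_n) (hT : optimal_maps lam S Y rho mu T)
    (phi : 'I_m.+1 -> 'rV[R]_n -> R)
    (hphi : kantorovich_potentials lam S Y rho mu phi) :
  {ae rho, forall x1, S x1 ->
    forall xs : 'I_m -> 'rV[R]_n, (forall i, Y (xs i)) ->
      residual lam phi (tcons x1 xs) >=
        4^-1 * \sum_(i < m) lam (lift ord0 i) ^+ 2
                 * sqnorm (tail_dev lam (tcons x1 xs) i
                           - tail_dev lam (graph_tuple T x1) i)
        - 3 / 2 * sqnorm (barycenter lam (tcons x1 xs)
                          - barycenter lam (graph_tuple T x1))}.
Proof.
have [y0 Yy0] : Y !=set0.
  case: m hN mu hmuY {lam hlam hlam1 T hT phi hphi} => // m' _ mu hmuY.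
  apply/set0P/eqP => Y0; have := hmuY ord0; rewrite Y0 measure0 => /eqP.
  by rewrite eq_sym onee_eq0.
have [[_ feasible] _ _] := hphi; have [trT _] := hT.
have := optimal_maps_contact hlam hlam1 hS hY hrhoS hrho Yy0 hphi hmuY hT.
apply: filterS => x1 contact Sx xs Yxs.
apply: (residual_ge_tail_dev hlam hlam1 feasible).
- exact: (@graph_tuple_dom _ _ _ _ _ (fun i=> cst (xs i))).
- by apply: graph_tuple_dom => // i; have [TY _ _] := trT i; exact: TY.
- by rewrite contact.
- by rewrite /graph_tuple /tcons unlift_none.
Qed.
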